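(* Let $X$ be a proper, geodesically complete CAT(0) space, let $x_0\in X$, and let $n\ge 0$ be an integer. Suppose that the linearly controlled dimension of $(\partial X,\overline d_{x_0})$ satisfies $\ell\text{-}\dim(\partial X,\overline d_{x_0})\le n$. Then the macroscopic dimension of $X$ is at most $2n+1$: $\dim_{mc}X\le 2n+1$.
   Context: A CAT(0) space is geodesically complete if every geodesic segment can be extended to a bi-infinite geodesic line. Geodesic rays are parametrized by arc length on $[0,\infty)$. The boundary $\partial X$ of a proper CAT(0) space $(X,d)$ is the set of equivalence classes of geodesic rays, where rays $\alpha,\alpha'$ are equivalent (asymptotic) if there is a constant $k$ with $d(\alpha(t),\alpha'(t))\le k$ for all $t\ge 0$. For each base point $x_0$, each class has a unique representative ray starting at $x_0$. For $x_0\in X$, the metric $\overline d_{x_0}$ on $\partial X$ is $$\overline d_{x_0}([\alpha],[\beta])=\int_0^\infty\frac{d(\alpha(r),\beta(r))}{e^r}\,dr,$$ where $\alpha,\beta$ are the representatives based at $x_0$. For a cover $\mathcal U$ of a metric space $Y$: $\mathrm{mesh}(\mathcal U)=\sup\{\mathrm{diam}(U): U\in\mathcal U\}$, and $\mathcal U$ is uniformly bounded if its mesh is finite; the order of $\mathcal U$ is the smallest integer $m$ such that each point of $Y$ lies in at most $m$ elements of $\mathcal U$; the Lebesgue number is $\mathcal L(\mathcal U)=\inf_{y\in Y}\sup\{d(y,Y-U): U\in\mathcal U\}$ (distance to the empty set is $+\infty$). The linearly controlled dimension of $Y$ is at most $n$, written $\ell\text{-}\dim Y\le n$, if there exist $c\ge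 1$ and $\lambda_0>0$ such that for all $0<\lambda\le\lambda_0$ there is a uniformly bounded open cover $\mathcal U$ of $Y$ with $\mathcal L(\mathcal U)\ge\lambda$, $\mathrm{mesh}(\mathcal U)\le c\lambda$ and order at most $n+1$. The macroscopic dimension of $Y$ is at most $n$, written $\dim_{mc}Y\le n$, if there exists a uniformly bounded open cover of $Y$ of order at most $n+1$. *)

(* Defs.v *)
From HB Require Import structures.
From mathcomp Require Import all_boot all_order all_algebra generic_quotient.
From mathcomp Require Import all_classical all_reals all_analysis.

Set Implicit Arguments.
Unset Strict Implicit.
Unset Printing Implicit Defensive.

Import Order.TTheory GRing.Theory Num.Theory.

Local Open Scope classical_set_scope.
Local Open Scope ring_scope.
Local Open Scope quotient_scope.
Local Open Scope card_scope.

Section Geodesics.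
Context {R : realType} {X : metricType R}.

Definition isometric_on (D : set R) (c : R -> X) : Prop :=
  forall s t, D s -> D t -> mdist (c s) (c t) = `|s - t|.

Definition geodesic_path (x y : X) (c : R -> X) : Prop :=
  [/\ isometric_on `[0, mdist x y] c, c 0 = x & c (mdist x y) = y].

Definition geodesic_segment (x y : X) (S : set X) : Prop :=
  exists2 c, geodesic_path x y c & S = c @` `[0, mdist x y].

Definition geodesic_line (c : R -> X) : Prop := isometric_on setT c.

End Geodesics.

Section Spaces.
Context {R : realType}.

Definition dist_E2 (u v : R * R) : R :=
  Num.sqrt ((u.1 - v.1) ^+ 2 + (u.2 - v.2) ^+ 2).

Variable X : metricType R.

Definition geodesic_space : Prop :=
  forall x y : X, exists c, geodesic_path x y c.

(* u in the Euclidean plane is a comparison point for x, lying on the side S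
   with endpoints p and q; the two equations put u on the segment [P, Q]. *)
Definition comparison_point (p q : X) (S : set X) (P Q : R * R)
    (x : X) (u : R * R) : Prop :=
  [/\ S x, dist_E2 P u = mdist p x & dist_E2 u Q = mdist x q].

Definition CAT0_inequality : Prop :=
  forall (p q r : X) (Spq Sqr Srp : set X) (P Q T : R * R),
    geodesic_segment p q Spq -> geodesic_segment q r Sqr ->
    geodesic_segment r p Srp ->
    dist_E2 P Q = mdist p q -> dist_E2 Q T = mdist q r ->
    dist_E2 T P = mdist r p ->
  let comp x u := [\/ comparison_point p q Spq P Q x u,
                      comparison_point q r Sqr Q T x u |
                      comparison_point r p Srp T P x u] in
  forall (x y : X) (u v : R * R),
    comp x u -> comp y v -> mdist x y <= dist_E2 u v.

Definition CAT0 : Prop := geodesic_space /\ CAT0_inequality.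

Definition proper_space : Prop :=
  forall (x : X) (r : R), compact [set y | mdist x y <= r].

(* Degenerate segments are excluded, so that a one-point space qualifies. *)
Definition geodesically_complete : Prop :=
  forall (x y : X) (c : R -> X), x != y -> geodesic_path x y c ->
  exists2 g, geodesic_line g & {in `[0, mdist x y], g =1 c}.

End Spaces.

(* The values of a ray on negative reals are irrelevant: no constraint is put
   on them, and asymptotic rays are identified in the boundary. *)
Record geodesic_ray {R : realType} (X : metricType R) := GeodesicRay {
  ray_fun :> R -> X ;
  ray_isometric : isometric_on `[0, +oo[ ray_fun }.

HB.instance Definition _ (R : realType) (X : metricType R) :=
  gen_eqMixin (geodesic_ray X).
HB.instance Definition _ (R : realType) (X : metricType R) :=
  gen_choiceMixin (geodesic_ray X).

Section Boundary.
Context {R : realType} (X : metricType R).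

Definition asymptotic (a b : geodesic_ray X) : bool :=
  `[< exists k : R, forall t, 0 <= t -> mdist (a t) (b t) <= k >].

Lemma asymptotic_refl : reflexive asymptotic.
Proof. by move=> a; apply/asboolP; exists 0 => t _; rewrite mdistxx. Qed.

Lemma asymptotic_sym : symmetric asymptotic.
Proof.
by move=> a b; apply/asboolP/asboolP => -[k kP]; exists k => t t0;
  rewrite metric_sym kP.
Qed.

Lemma asymptotic_trans : transitive asymptotic.
Proof.
move=> b a c /asboolP[k kP] /asboolP[l lP]; apply/asboolP; exists (k + l) => t t0.
by rewrite (le_trans (metric_triangle _ (b t) _))// lerD ?kP ?lP.
Qed.

Canonical asymptotic_equiv :=
  EquivRel asymptotic asymptotic_refl asymptotic_sym asymptotic_trans.

Definition boundary : Type := {eq_quot asymptotic_equiv}.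

(* The representative at x0 exists, and is unique on [0, +oo[, in a proper
   CAT(0) space; repr xi is a dummy default. *)
Definition ray_from (x0 : X) (xi : boundary) : geodesic_ray X :=
  xget (repr xi)
    [set a : geodesic_ray X |
      \pi_({eq_quot asymptotic_equiv}) a = xi /\ a 0 = x0].

Definition boundary_dist (x0 : X) (xi eta : boundary) : R :=
  \int[lebesgue_measure]_(r in `[0, +oo[)
    (mdist (ray_from x0 xi r) (ray_from x0 eta r) / expR r).

End Boundary.

(* Metric notions are stated for a bare distance d : Y -> Y -> R, so as to apply
   both to mdist and to boundary_dist x0. *)
Section Dimensions.
Context {R : realType} {Y : Type} (d : Y -> Y -> R).
Implicit Types (U A : set Y) (C : set (set Y)).

Definition dist_open U : Prop :=
  forall x, U x -> exists2 e : R, 0 < e & forall y, d x y < e -> U y.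

Definition dist_to (y : Y) A : \bar R := ereal_inf [set (d y z)%:E | z in A].

(* -oo for the empty set, as is the mesh of an empty cover; both are only ever
   bounded above by positive quantities. *)
Definition diam U : \bar R :=
  ereal_sup [set t | exists x y, [/\ U x, U y & t = (d x y)%:E]].

Definition mesh C : \bar R := ereal_sup [set diam U | U in C].

Definition lebesgue_number C : \bar R :=
  ereal_inf [set ereal_sup [set dist_to y (~` U) | U in C] | y in [set: Y]].

(* The order is the least m with this property, which is monotone in m. *)
Definition order_at_most C (m : nat) : Prop :=
  forall y, [set U | C U /\ U y] #<= `I_m.

Definition uniformly_bounded C : Prop := (mesh C < +oo)%E.

Definition open_cover C : Prop :=
  (forall U, C U -> dist_open U) /\ \bigcup_(U in C) U = [set: Y].

Definition ldim_le (n : nat) : Prop :=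
  exists c lambda0 : R, [/\ 1 <= c, 0 < lambda0 &
    forall lambda : R, 0 < lambda <= lambda0 ->
    exists C, [/\ open_cover C, uniformly_bounded C,
      (lambda%:E <= lebesgue_number C)%E, (mesh C <= (c * lambda)%:E)%E &
      order_at_most C n.+1]].

Definition dim_mc_le (n : nat) : Prop :=
  exists C, [/\ open_cover C, uniformly_bounded C & order_at_most C n.+1].

End Dimensions.

Lemma dist_open_mdist (R : realType) (X : metricType R) (U : set X) :
  dist_open (@mdist R X) U <-> open U.
Proof.
rewrite openE; split=> [oU x /oU[e e0 eU] | oU x Ux].
  by apply/nbhs_ballP; exists e => //= y; rewrite ballEmdist; exact: eU.
have /nbhs_ballP[e /= e0 eU] := oU _ Ux.
by exists e => // y xy; apply: eU; rewrite ballEmdist.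
Qed.

(* Main.v *)
Require Import Defs.
From mathcomp Require Import all_boot all_order all_algebra generic_quotient.
From mathcomp Require Import all_classical all_reals all_analysis.
From mathcomp Require Import measurable_realfun zify ring lra.

(** Covers of the boundary at the scale [exp (- k)] are pulled back to covers of
    the annuli [k <= d(x0, x) < k + 1] of [X], by sending a point to the rays
    from [x0] through it; the covers of all annuli are then put together.

    For two rays [a] and [b] from [x0], CAT(0) comparison makes
    [d(a(r), b(r)) / r] nondecreasing ([CAT0_rays_convex]).  So rays that are
    close at time [t] were close before, and after [t] they separate at speed at
    most 2; against the weight [exp (- r)] this makes their boundary distance at
    most a multiple of [exp (- t)], once [d(a(t), b(t))] is itself of order
    [exp (- t) / t] ([Rintegral_visual_integrand_le]).  Conversely the boundary
    distance bounds [d(a(t), b(t)) / exp (t + 1)] from above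
    ([dist_le_Rintegral_visual_integrand]).  At radius about [k] the boundary
    distance thus sees [X] at the scale [exp (- k)], up to constants independent
    of [k].

    Let [C] be a cover of the boundary of Lebesgue number at least
    [18 exp (- k)], mesh at most [18 c exp (- k)] and order at most [n + 1].  An
    element [U] of [C] yields the open set [shadow_nbhd k U]: the points very
    close to a point of the annulus that lies on a ray deep inside [U].  The
    Lebesgue number makes these sets cover the annulus.  A point of
    [shadow_nbhd k U] has all the rays through it in [U] ([shadow_nbhd_sub]),
    so the order does not grow, and the diameter is bounded independently of
    [k] ([annulus_cover_shadow]).  Geodesic completeness provides every point
    other than [x0] with a ray through it.  The finitely many annuli for which
    [18 exp (- k)] exceeds the range of the hypothesis are covered by one set
    each.

    The sets that cover an annulus stay within distance 1/2 of it, so that a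
    point meets the covers of at most two annuli.  The union of all the covers
    therefore has order at most [2 (n + 1) = (2 n + 1) + 1]
    ([dim_mc_le_annuli]). *)

Set Implicit Arguments.
Unset Strict Implicit.
Unset Printing Implicit Defensive.

Import Order.TTheory GRing.Theory Num.Theory.
Import numFieldNormedType.Exports.

Local Open Scope classical_set_scope.
Local Open Scope ring_scope.
Local Open Scope quotient_scope.

(** * Rays from a common point in a CAT(0) space *)

Section Rays.
Context {R : realType} {X : metricType R}.
Implicit Types (a b : R -> X) (p x y : X) (r s t : R).

Lemma dist_E2_eq (u v : R * R) (l : R) :
  0 <= l -> (u.1 - v.1) ^+ 2 + (u.2 - v.2) ^+ 2 = l ^+ 2 -> dist_E2 u v = l.
Proof. by move=> l0 e; rewrite /dist_E2 e sqrtr_sqr ger0_norm. Qed.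

Lemma ray_dist a s t : isometric_on `[0, +oo[ a -> 0 <= s -> 0 <= t ->
  mdist (a s) (a t) = `|s - t|.
Proof. by move=> ia s0 t0; apply: ia; rewrite /= in_itv /= andbT. Qed.

Lemma ray_dist0 a t : isometric_on `[0, +oo[ a -> 0 <= t -> mdist (a 0) (a t) = t.
Proof. by move=> ia t0; rewrite ray_dist// sub0r normrN ger0_norm. Qed.

Lemma ray_segment a t : isometric_on `[0, +oo[ a -> 0 <= t ->
  geodesic_segment (a 0) (a t) (a @` `[0, t]).
Proof.
move=> ia t0; exists a; rewrite ?ray_dist0//; split; rewrite ?ray_dist0//.
by move=> r s /=; rewrite !in_itv/= => /andP[r0 _] /andP[s0 _]; exact: ray_dist.
Qed.

Lemma ray_segment_rev a t : isometric_on `[0, +oo[ a -> 0 <= t ->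
  geodesic_segment (a t) (a 0) (a @` `[0, t]).
Proof.
move=> ia t0; have dE : mdist (a t) (a 0) = t by rewrite metric_sym ray_dist0.
exists (fun w => a (t - w)); rewrite ?dE.
  split; rewrite ?dE ?subr0 ?subrr//.
  move=> r s /=; rewrite !in_itv/= => /andP[r0 rt] /andP[s0 st].
  by rewrite ray_dist ?subr_ge0// distrC; congr `|_|; ring.
apply/seteqP; split=> x /= [w]; rewrite in_itv/= => /andP[w0 wt] <-;
  exists (t - w); rewrite /= ?in_itv/= ?subKr//; apply/andP; split; lra.
Qed.

(** Comparison in the isosceles triangle with vertices [a 0], [a t] and [b t]:
    in the Euclidean plane, the points at distance [s] from the apex on the two
    equal sides are at distance [s / t] times the base. *)
Lemma CAT0_rays_convex a b s t : CAT0 X ->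
  isometric_on `[0, +oo[ a -> isometric_on `[0, +oo[ b -> a 0 = b 0 ->
  0 <= s <= t -> t * mdist (a s) (b s) <= s * mdist (a t) (b t).
Proof.
move=> [geoX catX] ia ib ab0 /andP[s0 st].
have t0 : 0 <= t := le_trans s0 st.
have [t_eq0|t_neq0] := eqVneq t 0.
  have s_eq0 : s = 0 by lra.
  by rewrite t_eq0 s_eq0 !mul0r.
have tgt0 : 0 < t by rewrite lt_neqAle eq_sym t_neq0.
set D := mdist (a t) (b t).
have D0 : 0 <= D := mdist_ge0 _ _.
have Dle : D <= 2 * t.
  rewrite (le_trans (metric_triangle _ (a 0) _))// metric_sym ray_dist0//.
  by rewrite ab0 ray_dist0//; lra.
have [c cP] := geoX (a t) (b t).
(* The comparison triangle is (0, 0), (t, 0), (x, y): the abscissa x comes from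
   the law of cosines, and y closes the side of length t. *)
pose x := (2 * t ^+ 2 - D ^+ 2) / (2 * t).
have xt : 2 * t * x = 2 * t ^+ 2 - D ^+ 2 by rewrite /x; field.
have x2 : 0 <= t ^+ 2 - x ^+ 2.
  have -> : t ^+ 2 - x ^+ 2 = (t - x) * (t + x) by ring.
  have D2 : D ^+ 2 <= 4 * t ^+ 2.
    have -> : 4 * t ^+ 2 = (2 * t) ^+ 2 by ring.
    by rewrite ler_pXn2r// nnegrE mulr_ge0.
  apply: mulr_ge0.
    rewrite -(pmulr_rge0 _ (_ : 0 < 2 * t)) ?mulr_gt0// mulrBr xt.
    have := sqr_ge0 D; lra.
  rewrite -(pmulr_rge0 _ (_ : 0 < 2 * t)) ?mulr_gt0// mulrDr xt; lra.
pose y := Num.sqrt (t ^+ 2 - x ^+ 2).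
have y2 : y ^+ 2 = t ^+ 2 - x ^+ 2 by rewrite sqr_sqrtr.
pose l := s / t.
have lt : l * t = s by rewrite /l divfK.
have l0 : 0 <= l by rewrite divr_ge0.
have := catX (a 0) (a t) (b t) _ _ _ (0, 0) (t, 0) (x, y)
  (ray_segment ia t0) (ex_intro2 _ _ c cP erefl) _ _ _ _.
have seg_b : geodesic_segment (b t) (a 0) (b @` `[0, t]).
  by rewrite ab0; exact: ray_segment_rev.
move=> /(_ _ seg_b) cmp.
have PQ : dist_E2 (0, 0) (t, 0) = mdist (a 0) (a t).
  by rewrite ray_dist0//; apply: dist_E2_eq => //=; ring.
have QT : dist_E2 (t, 0) (x, y) = D.
  apply: dist_E2_eq => //=; rewrite sub0r sqrrN y2.
  by rewrite sqrrB; lra.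
have TP : dist_E2 (x, y) (0, 0) = mdist (b t) (a 0).
  rewrite metric_sym ab0 ray_dist0//; apply: dist_E2_eq => //=.
  by rewrite !subr0 y2; ring.
have memS : (`[0, t]%classic : set R) s by rewrite /= in_itv/= s0.
have h : mdist (a s) (b s) <= dist_E2 (s, 0) (l * x, l * y).
  apply: (cmp PQ QT TP).
- apply: Or31; split.
  + by exists s.
  + by rewrite ray_dist0//; apply: dist_E2_eq => //=; ring.
  + rewrite ray_dist// ler0_norm ?subr_le0// opprB; apply: dist_E2_eq => /=.
      by rewrite subr_ge0.
    by ring.
- apply: Or33; split.
  + by exists s.
  + rewrite ray_dist// ger0_norm ?subr_ge0//; apply: dist_E2_eq => /=.
      by rewrite subr_ge0.
    transitivity ((1 - l) ^+ 2 * (x ^+ 2 + y ^+ 2)); first by ring.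
    by rewrite y2 -lt; ring.
  + rewrite ab0 metric_sym ray_dist0//; apply: dist_E2_eq => //=.
    transitivity (l ^+ 2 * (x ^+ 2 + y ^+ 2)); first by ring.
    by rewrite y2 -lt; ring.
have E : dist_E2 (s, 0) (l * x, l * y) = l * D.
  apply: dist_E2_eq => /=; first by rewrite mulr_ge0.
  rewrite -QT /dist_E2 /= exprMn sqr_sqrtr ?addr_ge0 ?sqr_ge0// -lt; ring.
rewrite E in h.
rewrite (_ : s * D = t * (l * D)) ?ler_pM2l//.
by rewrite mulrA (mulrC t) lt.
Qed.

Lemma CAT0_rays_monotone a b s t : CAT0 X ->
  isometric_on `[0, +oo[ a -> isometric_on `[0, +oo[ b -> a 0 = b 0 ->
  0 <= s <= t -> mdist (a s) (b s) <= mdist (a t) (b t).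
Proof.
move=> catX ia ib ab0 st; have := CAT0_rays_convex catX ia ib ab0 st.
case/andP: st => s0 st.
have [-> _|t_neq0 h] := eqVneq s t; first by [].
have tgt0 : 0 < t by apply: le_lt_trans s0 _; rewrite lt_neqAle t_neq0.
rewrite -(ler_pM2l tgt0) (le_trans h)// ler_wpM2r// mdist_ge0//.
Qed.

(** By [CAT0_rays_convex], a positive distance at one time grows at least
    linearly, hence exceeds any bound.  So a boundary point is represented by a
    single ray from each base point. *)
Lemma CAT0_ray_unique a b (k : R) : CAT0 X ->
  isometric_on `[0, +oo[ a -> isometric_on `[0, +oo[ b -> a 0 = b 0 ->
  (forall t, 0 <= t -> mdist (a t) (b t) <= k) ->
  forall s, 0 <= s -> a s = b s.
Proof.
move=> catX ia ib ab0 hk s s0; apply: mdist_positivity; apply/eqP.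
rewrite eq_le mdist_ge0 andbT leNgt; apply/negP => d0.
set d := mdist _ _ in d0.
have k0 : 0 <= k := le_trans (mdist_ge0 _ _) (hk 0 (lexx _)).
(* At this time, linear growth from d at time s has gone beyond k. *)
pose t := s + s * k / d + 1.
have skd : 0 <= s * k / d by rewrite divr_ge0 ?mulr_ge0// ltW.
have st : 0 <= s <= t by rewrite s0 /t; lra.
have := CAT0_rays_convex catX ia ib ab0 st; rewrite -/d.
have t0 : 0 <= t by rewrite /t; lra.
have : s * mdist (a t) (b t) <= s * k by rewrite ler_wpM2l// hk.
have td : t * d = s * d + s * k + d by rewrite /t; field; rewrite gt_eqF.
have := mulr_ge0 s0 (ltW d0); lra.
Qed.

Lemma rays_dist_le a b r t : isometric_on `[0, +oo[ a ->
  isometric_on `[0, +oo[ b -> 0 <= r -> 0 <= t ->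
  mdist (a r) (b r) <= mdist (a t) (b t) + 2 * `|r - t|.
Proof.
move=> ia ib r0 t0.
have h1 := metric_triangle (a r) (a t) (b r).
have h2 := metric_triangle (a t) (b t) (b r).
move: h1 h2; rewrite (ray_dist ia)// (ray_dist ib t0 r0) (distrC t r); lra.
Qed.

End Rays.

(** * The boundary distance compared with the distance at time t *)

Section Visual_integrand.
Context {R : realType} {X : metricType R}.
Implicit Types (a b : R -> X) (r s t : R).
Local Notation mu := (@lebesgue_measure R).

Definition visual_integrand a b r : R := mdist (a r) (b r) / expR r.

Lemma visual_integrand_ge0 a b r : 0 <= visual_integrand a b r.
Proof. by rewrite divr_ge0 ?mdist_ge0 ?expR_ge0. Qed.

Lemma measurable_visual_integrand a b : isometric_on `[0, +oo[ a ->
  isometric_on `[0, +oo[ b -> measurable_fun (`[0, +oo[%classic : set R)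
    (visual_integrand a b).
Proof.
move=> ia ib.
(* Nothing is known of rays at negative times; reflecting them there gives a
   2-Lipschitz, hence continuous, function on the whole line. *)
pose g r := mdist (a `|r|) (b `|r|).
have gL r s : `|g r - g s| <= 2 * `|r - s|.
  have h1 := rays_dist_le ia ib (normr_ge0 r) (normr_ge0 s).
  have h2 := rays_dist_le ia ib (normr_ge0 s) (normr_ge0 r).
  have h3 := ler_dist_dist r s.
  rewrite ler_norml; rewrite (distrC `|s|) in h2; rewrite -/(g r) -/(g s) in h1 h2.
  by apply/andP; split; lra.
have cg : continuous g.
  move=> x; apply/cvgrPdist_le => e e0.
  near=> y; rewrite (le_trans (gL _ _))// -ler_pdivlMl// mulrC.
  by near: y; apply: cvgr_dist_le => //; rewrite divr_gt0.
apply: (@eq_measurable_fun _ _ _ _ _ (fun r => g r / expR r)).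
  move=> r; rewrite inE/= in_itv/= andbT => r0.
  by rewrite /visual_integrand /g ger0_norm.
apply: (measurable_funS measurableT) => //.
apply: continuous_measurable_fun => x.
apply: cvgM; first exact: cg.
by apply: cvgV; [rewrite gt_eqF ?expR_gt0|exact: continuous_expR].
Unshelve. all: by end_near. Qed.

Lemma continuous_exp_half : continuous (fun r : R => expR (- (r / 2))).
Proof.
move=> x; apply: continuous_comp; last exact: continuous_expR.
by apply: cvgN; apply: cvgMr_tmp.
Qed.

Lemma integral_exp_tail t :
  (\int[mu]_(r in `[t, +oo[) (expR (- (r / 2)))%:E = (2 * expR (- (t / 2)))%:E)%E.
Proof.
pose F r : R := - (2 * expR (- (r / 2))).
have dF r : is_derive r 1 F (expR (- (r / 2))).
  have dg : is_derive r 1 (fun r : R => - (r / 2)) (- (1 / 2)).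
    have -> : (fun r : R => - (r / 2)) = (- (1 / 2)) \*: id.
      by apply/funext => u; rewrite /= /GRing.scale /=; field.
    by rewrite -[X in is_derive _ _ _ X]mulr1; exact: is_deriveZ.
  have := @is_derive1_comp _ expR (fun r : R => - (r / 2)) r _ _ _ dg.
  move=> /(_ _ (is_derive_expR _)) /(is_deriveZ 2) /is_deriveN.
  by move=> dF; apply: (is_derive_eq dF); rewrite /GRing.scale /=; field.
have cF r : {for r, continuous F}.
  by apply: differentiable_continuous; apply/derivable1_diffP; case: (dF r).
rewrite (@ge0_continuous_FTC2y _ _ F _ 0).
- by rewrite -EFinB sub0r /F opprK.
- by move=> x _; exact: expR_ge0.
- exact: continuous_subspaceT continuous_exp_half.
- rewrite -oppr0 -[in X in _ --> - X](mulr0 2).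
  apply: cvgN; apply: cvgMl_tmp.
  apply: (cvg_comp (fun x : R => x / 2) (fun x => expR (- x))); last first.
    exact: cvgr_expR.
  apply: gt0_cvgMly => //.
- by move=> x _; case: (dF x).
- by apply: cvg_at_right_filter; exact: cF.
- by move=> x _; rewrite derive1E; case: (dF x).
Qed.

End Visual_integrand.

Section Boundary_distance.
Context {R : realType} {X : metricType R}.
Implicit Types (a b : R -> X) (r s t : R).
Local Notation mu := (@lebesgue_measure R).
Local Notation halfline := (`[0, +oo[%classic : set R).

(** Before time [t] the rays are within [e] and the weight is at most 1, which
    accounts for [e * t]; after [t], the distance is at most [1 + 2 (r - t)],
    which the tail of [exp (- r)] integrates to a multiple of [exp (- t)]. *)
Lemma integral_visual_integrand_le a b (e t : R) : CAT0 X ->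
  isometric_on `[0, +oo[ a -> isometric_on `[0, +oo[ b -> a 0 = b 0 ->
  0 <= t -> mdist (a t) (b t) <= e -> e <= 1 ->
  (\int[mu]_(r in halfline) (visual_integrand a b r)%:E <=
     (e * t + 8 * expR (- t))%:E)%E.
Proof.
move=> catX ia ib ab0 t0 dle e1.
have mw : measurable_fun halfline (EFin \o visual_integrand a b).
  by apply/measurable_EFinP; exact: measurable_visual_integrand.
have split_halfline : halfline = `[0, t[ `|` `[t, +oo[.
  by rewrite -itv_bndbnd_setU// bnd_simp.
have sub1 : (`[0, t[ : set R) `<=` halfline.
  by rewrite split_halfline; exact: subsetUl.
have sub2 : (`[t, +oo[ : set R) `<=` halfline.
  by rewrite split_halfline; exact: subsetUr.
rewrite split_halfline ge0_integral_setU//=; last 3 first.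
- by rewrite -split_halfline.
- by move=> r _; rewrite lee_fin visual_integrand_ge0.
- apply/disj_setPS => r [] /=; rewrite !in_itv/= andbT => /andP[_ rt] tr.
  by move: rt; rewrite ltNge tr.
rewrite EFinD; apply: leeD.
- apply: (@le_trans _ _ (\int[mu]_(r in `[0%R, t[) cst e%:E r)%E).
    apply: ge0_le_integral => //=.
    + by move=> r _; rewrite lee_fin visual_integrand_ge0.
    + exact: measurable_funS sub1 mw.
    + move=> r; rewrite in_itv/= => /andP[r0 rt]; rewrite lee_fin.
      rewrite ler_pdivrMr ?expR_gt0//.
      have le_e : mdist (a r) (b r) <= e.
        by rewrite (le_trans _ dle)// CAT0_rays_monotone// r0 ltW.
      rewrite (le_trans le_e)// ler_peMr//.
        exact: le_trans (mdist_ge0 _ _) dle.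
      by rewrite (le_trans _ (expR_ge1Dx _))// lerDl.
  rewrite integral_cst//= lebesgue_measure_itv/= lte_fin; case: ifPn => [_|].
    by rewrite oppr0 adde0.
  by rewrite mule0 lee_fin mulr_ge0// (le_trans (mdist_ge0 _ _) dle).
(* The linear bound 1 + 2 (r - t) is replaced by 4 exp ((r - t) / 2), whose product
   with exp (- r) has an elementary primitive. *)
- apply: (@le_trans _ _ (\int[mu]_(r in `[t, +oo[)
      ((4 * expR (- (t / 2)))%:E * (expR (- (r / 2)))%:E))%E).
    apply: ge0_le_integral => //=.
    + by move=> r _; rewrite lee_fin visual_integrand_ge0.
    + exact: measurable_funS sub2 mw.
    + apply/(measurable_EFinP _ (fun r => 4 * expR (- (t / 2)) * expR (- (r / 2)))).
      apply: (measurable_funS measurableT) => //.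
      apply: measurable_funM => //.
      exact: continuous_measurable_fun continuous_exp_half.
    + move=> r; rewrite in_itv/= andbT => tr; rewrite -EFinM lee_fin.
      have r0 : 0 <= r := le_trans t0 tr.
      rewrite ler_pdivrMr ?expR_gt0// -!mulrA -!expRD.
      have -> : - (t / 2) + (- (r / 2) + r) = (r - t) / 2 by field.
      have h1 := rays_dist_le ia ib r0 t0.
      rewrite ger0_norm ?subr_ge0// in h1.
      have h2 := expR_ge1Dx ((r - t) / 2); lra.
  rewrite ge0_integralZl//=.
  + rewrite integral_exp_tail -EFinM lee_fin.
    have -> : expR (- t) = expR (- (t / 2)) * expR (- (t / 2)).
      by rewrite -expRD; congr expR; field.
    by rewrite le_eqVlt; apply/orP; left; apply/eqP; ring.
  + apply/measurable_EFinP; apply: (measurable_funS measurableT) => //.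
    exact: continuous_measurable_fun continuous_exp_half.
Qed.

Lemma integral_visual_integrand_fin_num a b : CAT0 X ->
  isometric_on `[0, +oo[ a -> isometric_on `[0, +oo[ b -> a 0 = b 0 ->
  (\int[mu]_(r in halfline) (visual_integrand a b r)%:E)%E \is a fin_num.
Proof.
move=> catX ia ib ab0; rewrite ge0_fin_numE; last first.
  by apply: integral_ge0 => r _; rewrite lee_fin visual_integrand_ge0.
apply: le_lt_trans (ltry _).
apply: (integral_visual_integrand_le (e := 0) (t := 0)) => //.
by rewrite ab0 mdistxx.
Qed.

Lemma Rintegral_visual_integrand_le a b (e t : R) : CAT0 X ->
  isometric_on `[0, +oo[ a -> isometric_on `[0, +oo[ b -> a 0 = b 0 ->
  0 <= t -> mdist (a t) (b t) <= e -> e <= 1 ->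
  \int[mu]_(r in halfline) visual_integrand a b r <= e * t + 8 * expR (- t).
Proof.
move=> catX ia ib ab0 t0 dle e1.
rewrite -lee_fin fineK; first exact: integral_visual_integrand_le.
exact: integral_visual_integrand_fin_num.
Qed.

(** On [[t, t + 1]] the distance between the rays is at least its value at [t]
    and the weight is at least [exp (- (t + 1))]. *)
Lemma dist_le_Rintegral_visual_integrand a b t : CAT0 X ->
  isometric_on `[0, +oo[ a -> isometric_on `[0, +oo[ b -> a 0 = b 0 ->
  0 <= t -> mdist (a t) (b t) <=
    expR (t + 1) * \int[mu]_(r in halfline) visual_integrand a b r.
Proof.
move=> catX ia ib ab0 t0.
rewrite -ler_pdivrMl ?expR_gt0// -expRN -lee_fin fineK; last first.
  exact: integral_visual_integrand_fin_num.
have mw : measurable_fun halfline (EFin \o visual_integrand a b).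
  by apply/measurable_EFinP; exact: measurable_visual_integrand.
pose I : set R := `[t, t + 1]%classic.
have mI : measurable I by exact: measurable_itv.
have sub : I `<=` halfline.
  by move=> r; rewrite /I /= !in_itv/= andbT => /andP[+ _]; exact: le_trans.
apply: (@le_trans _ _ (\int[mu]_(r in I) (visual_integrand a b r)%:E)%E);
  last by apply: ge0_subset_integral => //= r _;
          rewrite lee_fin visual_integrand_ge0.
apply: (@le_trans _ _ (\int[mu]_(r in I)
    cst (expR (- (t + 1)) * mdist (a t) (b t))%:E r)%E).
  rewrite integral_cst//= lebesgue_measure_itv/= lte_fin ltrDl ltr01.
  by rewrite -EFinB addrAC subrr add0r mule1.
apply: ge0_le_integral => //=.
- by move=> r _; rewrite lee_fin mulr_ge0 ?expR_ge0 ?mdist_ge0.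
- exact: measurable_funS sub mw.
- move=> r; rewrite /I /= in_itv/= => /andP[tr rt].
  rewrite lee_fin /visual_integrand mulrC -expRN.
  apply: ler_pM; rewrite ?mdist_ge0 ?expR_ge0//.
    by rewrite CAT0_rays_monotone// t0.
  by rewrite ler_expR lerN2.
Qed.

End Boundary_distance.

(** * Assembling covers of annuli *)

Lemma card_le_setU (T : Type) (A B : set T) m n :
  (A #<= `I_m -> B #<= `I_n -> A `|` B #<= `I_(m + n))%card.
Proof.
move=> /pcard_leP[f] /pcard_leP[g].
(* Values on A fill the first m places, those on the rest of B the next n. *)
pose h x := if x \in A then f x else (m + g x)%N.
have fA x : A x -> (f x < m)%N by move=> Ax; exact: (@funS _ _ _ _ f x Ax).
have gB x : B x -> (g x < n)%N by move=> Bx; exact: (@funS _ _ _ _ g x Bx).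
have hinj : {in A `|` B &, injective h}.
  move=> x y; rewrite !inE /h => xAB yAB.
  case: ifPn => xA; case: ifPn => yA.
  - by move: xA yA; exact: inj.
  - move=> fxE; have := fA x (set_mem xA).
    by rewrite fxE ltnNge leq_addr.
  - move=> fyE; have := fA y (set_mem yA).
    by rewrite -fyE ltnNge leq_addr.
  - move=> /addnI.
    have xB : x \in B.
      by rewrite inE; case: xAB => // /mem_set xA'; rewrite xA' in xA.
    have yB : y \in B.
      by rewrite inE; case: yAB => // /mem_set yA'; rewrite yA' in yA.
    by move: xB yB; exact: inj.
rewrite -(card_le_eql (inj_card_eq hinj)); apply: subset_card_le => _ [x xAB <-].
rewrite /h /=; case: ifPn => xA.
  by rewrite ltn_addr// fA//; exact: set_mem.
case: xAB => [/mem_set xA'|xB]; first by rewrite xA' in xA.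
by rewrite ltn_add2l gB.
Qed.

Section Covers_of_X.
Context {R : realType} (X : metricType R) (x0 : X).
Implicit Types (x y : X) (U V : set X) (k m n : nat).

(** The annulus [k <= d(x0, y) < k + 1] thickened by 1/2: open, and still such
    that no point lies in more than two of them. *)
Definition shell k : set X := [set y | k%:R - 1 / 2 < mdist x0 y < k%:R + 3 / 2].

Definition annulus_cover k m (B : R) (F : set (set X)) : Prop :=
  [/\ forall V, F V -> dist_open (@mdist R X) V,
      forall V, F V -> V `<=` shell k,
      forall V x y, F V -> V x -> V y -> mdist x y <= B,
      forall x, k%:R <= mdist x0 x < k.+1%:R -> exists2 V, F V & V x &
      order_at_most F m].

(** A point lies in at most two consecutive shells, hence in at most [2 (m + 1)]
    elements of the union of the covers. *)
Lemma dim_mc_le_annuli m (B : R) :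
  (forall k, exists F, annulus_cover k m.+1 B F) ->
  dim_mc_le (@mdist R X) (2 * m + 1).
Proof.
move=> /choice[F FP]; exists (\bigcup_k F k); split.
- split=> [V [k _ FV]|]; first by have [oF _ _ _ _] := FP k; exact: oF.
  apply/seteqP; split=> // x _.
  have [_ _ _ + _] := FP (Num.truncn (mdist x0 x)).
  move=> /(_ x); rewrite truncn_itv ?mdist_ge0// => /(_ isT)[V FV Vx].
  by exists V => //; exists (Num.truncn (mdist x0 x)).
- apply: (@le_lt_trans _ _ B%:E); last exact: ltry.
  apply: ge_ereal_sup => _ [V [k _ FV] <-].
  apply: ge_ereal_sup => _ [x [y [Vx Vy ->]]]; rewrite lee_fin.
  by have [_ _ bF _ _] := FP k; exact: (bF V).
- move=> y; have y0 := mdist_ge0 x0 y.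
  (* The shells containing y have index j or j - 1, for j the integral part of
     d(x0, y) + 1/2. *)
  have y_half : 0 <= mdist x0 y + 1 / 2 by lra.
  have /andP[] := truncn_itv y_half; set j := Num.truncn _ => jle jgt.
  have -> : (2 * m + 1).+1 = (m.+1 + m.+1)%N by rewrite mul2n -addnn; lia.
  have [_ _ _ _ ordj] := FP j; have [_ _ _ _ ordj1] := FP j.-1.
  apply: card_le_trans (card_le_setU (ordj1 y) (ordj y)).
  apply: subset_card_le => V [[k _ FkV] Vy].
  have /= /andP[ky yk] : shell k y by have [_ sF _ _ _] := FP k; exact: (sF V).
  have kj : (k <= j)%N.
    by rewrite -ltnS -(ltr_nat R) (lt_trans _ jgt)//; lra.
  have jk : (j <= k.+1)%N.
    by rewrite -ltnS -(ltr_nat R) -[k.+2]addn2 natrD (le_lt_trans jle)//; lra.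
  have [kE|kE] : k = j.-1 \/ k = j by lia.
    by left; rewrite -kE.
  by right; rewrite -kE.
Qed.

Lemma dist_open_shell k : dist_open (@mdist R X) (shell k).
Proof.
move=> x /andP[kx xk].
exists (Num.min (mdist x0 x - (k%:R - 1 / 2)) (k%:R + 3 / 2 - mdist x0 x)).
  by rewrite lt_min !subr_gt0 kx.
move=> y; rewrite lt_min => /andP[h1 h2] /=.
have := metric_triangle x0 x y; have := metric_triangle x0 y x.
by rewrite (metric_sym y x) => h3 h4; apply/andP; split; lra.
Qed.

Lemma dist_shell k x y : shell k x -> shell k y -> mdist x y <= 2 * k%:R + 3.
Proof.
move=> /andP[_ hx] /andP[_ hy].
by have := metric_triangle x x0 y; rewrite (metric_sym x x0); lra.
Qed.

Lemma annulus_cover_shell k m :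
  annulus_cover k m.+1 (2 * k%:R + 3) [set shell k].
Proof.
split=> [V ->|V -> //|V x y ->|x /andP[kx xk]|y].
- exact: dist_open_shell.
- exact: dist_shell.
- by exists (shell k) => //=; rewrite -natr1 in xk; apply/andP; split; lra.
- apply: (@card_le_trans _ _ _ ((fun=> shell k) @` `I_1)).
    by apply: subset_card_le => V [/= -> _]; exists 0%N.
  by apply: card_le_trans (card_image_le _ _) _; rewrite card_le_II.
Qed.

Lemma annulus_cover_le k m (B B' : R) F : B <= B' ->
  annulus_cover k m B F -> annulus_cover k m B' F.
Proof.
move=> BB' [h1 h2 h3 h4 h5]; split=> // V x y FV Vx Vy.
exact: le_trans (h3 V x y FV Vx Vy) BB'.
Qed.

End Covers_of_X.

(** * Pulling back boundary covers to annuli *)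

Section Shadow_covers.
Context {R : realType} (X : metricType R) (x0 : X) (catX : CAT0 X).
Implicit Types (x y : X) (xi eta : boundary X) (k m : nat) (t : R).

(** The condition at time 0 has content: [ray_from] returns an arbitrary
    representative when the class has none based at [x0]. *)
Definition ray_through x xi : Prop :=
  ray_from x0 xi 0 = x0 /\ ray_from x0 xi (mdist x0 x) = x.

Context (gcX : geodesically_complete X).

(** Half of a line extending the segment from [x0] to [x] is such a ray, and by
    [CAT0_ray_unique] it agrees with the representative of its class chosen by
    [ray_from]. *)
Lemma exists_ray_through x : x != x0 -> exists xi, ray_through x xi.
Proof.
move=> xx0; have [c cP] := catX.1 x0 x.
have x0x : x0 != x by rewrite eq_sym.
have [g gL gc] := gcX x0x cP.
have [_ c0 cx] := cP.
have g0 : g 0 = x0 by rewrite gc// in_itv/= lexx mdist_ge0.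
have gx : g (mdist x0 x) = x by rewrite gc// in_itv/= lexx mdist_ge0.
have ig : isometric_on `[0, +oo[ g by move=> s t _ _; exact: gL.
pose a := GeodesicRay ig.
pose xi : boundary X := \pi_({eq_quot asymptotic_equiv X}) a.
exists xi.
have [/eqmodP/asboolP[l lP] r0] := xgetPex (repr xi)
  (ex_intro (fun b : geodesic_ray X =>
     \pi_({eq_quot asymptotic_equiv X}) b = xi /\ b 0 = x0) a (conj erefl g0)).
split=> //; rewrite -[RHS]gx.
apply: (CAT0_ray_unique catX _ ig _ lP) => //; last exact: mdist_ge0.
- exact: ray_isometric.
- by rewrite g0.
Qed.

(** The ray of [eta] is at [y] at time [d(x0, y)], which differs from [d(x0, x)]
    by less than [e]; so both rays are within [2 e] at time [d(x0, x)]. *)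
Lemma boundary_dist_close k (e : R) x y xi eta :
  ray_through x xi -> ray_through y eta ->
  mdist x y < e -> k%:R <= mdist x0 x < k.+1%:R -> 2 * e <= 1 ->
  boundary_dist x0 xi eta <= 2 * e * k.+1%:R + 8 * expR (- k%:R).
Proof.
move=> [xi0 xix] [eta0 etay] xy /andP[kx xk] e1.
set t := mdist x0 x in xix kx xk *.
have t0 : 0 <= t := mdist_ge0 _ _.
have ix := ray_isometric (ray_from x0 xi).
have ie := ray_isometric (ray_from x0 eta).
have e0 : 0 < e := le_lt_trans (mdist_ge0 _ _) xy.
have yx : `|mdist x0 y - t| <= mdist x y.
  have h1 := metric_triangle x0 x y; have h2 := metric_triangle x0 y x.
  rewrite (metric_sym y x) -/t in h2; rewrite -/t in h1.
  by rewrite ler_norml; apply/andP; split; lra.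
have close : mdist (ray_from x0 xi t) (ray_from x0 eta t) <= 2 * e.
  rewrite xix.
  have := metric_triangle x y (ray_from x0 eta t).
  rewrite -[in X in _ <= _ + X]etay (ray_dist ie)//; last exact: mdist_ge0.
  lra.
have same : ray_from x0 xi 0 = ray_from x0 eta 0 by rewrite xi0 eta0.
have h := Rintegral_visual_integrand_le catX ix ie same t0 close e1.
apply: (le_trans h); apply: lerD.
  by rewrite ler_wpM2l ?(ltW xk)// mulr_ge0// ltW.
by rewrite ler_wpM2l// ler_expR lerN2.
Qed.

Lemma dist_le_boundary_dist x y xi eta :
  ray_through x xi -> ray_through y eta ->
  mdist x y <= expR (mdist x0 x + 1) * boundary_dist x0 xi eta
               + `|mdist x0 x - mdist x0 y|.
Proof.
move=> [xi0 xix] [eta0 etay].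
have ix := ray_isometric (ray_from x0 xi).
have ie := ray_isometric (ray_from x0 eta).
have same : ray_from x0 xi 0 = ray_from x0 eta 0 by rewrite xi0 eta0.
have h := dist_le_Rintegral_visual_integrand catX ix ie same (mdist_ge0 x0 x).
apply: (le_trans (metric_triangle _ (ray_from x0 eta (mdist x0 x)) _)).
apply: lerD; first by rewrite xix in h.
by rewrite -[in leLHS]etay (ray_dist ie) ?mdist_ge0.
Qed.

(** Small enough that moving a point of the annulus by [radius k] moves the rays
    through it by at most [9 exp (- k)] in the boundary: after multiplication
    by the time, which is less than [k + 1], the displacement [2 * radius k]
    contributes [exp (- k)], and the tail contributes [8 exp (- k)]. *)
Definition radius k : R := expR (- k%:R) / (2 * k.+1%:R).

(** Taking a union of balls makes the set open at once; the depth
    [9 exp (- k)] in [U] absorbs both the radius of the balls and the choice of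
    a ray through a point. *)
Definition shadow_nbhd k (U : set (boundary X)) : set X :=
  [set y | exists x, [/\ k%:R <= mdist x0 x < k.+1%:R, mdist x y < radius k &
    exists2 xi, ray_through x xi &
      ((9 * expR (- k%:R))%:E < dist_to (boundary_dist x0) xi (~` U))%E]].

Lemma radius_gt0 k : 0 < radius k.
Proof. by rewrite divr_gt0 ?expR_gt0// mulr_gt0. Qed.

Lemma radius_mul k : 2 * radius k * k.+1%:R = expR (- k%:R).
Proof.
have : k.+1%:R != 0 :> R by rewrite pnatr_eq0.
by rewrite /radius; move: (k.+1%:R) => q q0; field.
Qed.

Lemma radius_le k : 2 * radius k <= 1.
Proof.
have h := radius_mul k; have r0 := radius_gt0 k.
have : expR (- k%:R) <= 1 :> R by rewrite -expR0 ler_expR oppr_le0.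
rewrite -h; apply: le_trans; rewrite ler_peMr ?ler1n//; lra.
Qed.

Lemma shadow_nbhd_sub k U y eta :
  shadow_nbhd k U y -> ray_through y eta -> U eta.
Proof.
move=> [x [kx xy [xi xix xiU]]] yeta; apply: contrapT => nU.
move: xiU; apply/negP; rewrite -leNgt.
apply: (@le_trans _ _ (boundary_dist x0 xi eta)%:E).
  by apply: ereal_inf_lbound; exists eta.
rewrite lee_fin (le_trans (boundary_dist_close xix yeta xy kx (radius_le k)))//.
by rewrite radius_mul; lra.
Qed.

Lemma shadow_nbhd_shell k U : shadow_nbhd k U `<=` shell x0 k.
Proof.
move=> y [x [/andP[kx xk] xy _]].
have h1 := metric_triangle x0 x y; have h2 := metric_triangle x0 y x.
rewrite (metric_sym y x) in h2; have h3 := radius_le k; rewrite -natr1 in xk.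
by apply/andP; split; lra.
Qed.

Lemma dist_open_shadow_nbhd k U : dist_open (@mdist R X) (shadow_nbhd k U).
Proof.
move=> y [x [kx xy xiP]]; exists (radius k - mdist x y); first by rewrite subr_gt0.
move=> z yz; exists x; split=> //.
by rewrite (le_lt_trans (metric_triangle _ y _))// -ltrBrDl.
Qed.

Lemma shell_ray_through k y : (0 < k)%N -> shell x0 k y ->
  exists eta, ray_through y eta.
Proof.
move=> k0 /andP[ky _]; apply: exists_ray_through.
rewrite eq_sym -mdist_gt0; apply: le_lt_trans ky.
have : 1 <= k%:R :> R by rewrite ler1n.
lra.
Qed.

(** The bound on the order holds because one ray [eta] through [y] lies in every
    [U] with [y] in [shadow_nbhd k U].  In the bound on the diameter, the factor
    [exp (- k)] of the mesh is compensated by the expansion [exp (t + 1)] of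
    [dist_le_boundary_dist], with [t < k + 3/2]; the 2 bounds the difference of
    the distances to [x0]. *)
Lemma annulus_cover_shadow k m (c : R) (C : set (set (boundary X))) :
  (0 < k)%N -> 0 <= c ->
  ((18 * expR (- k%:R))%:E <= lebesgue_number (boundary_dist x0) C)%E ->
  (mesh (boundary_dist x0) C <= (c * (18 * expR (- k%:R)))%:E)%E ->
  order_at_most C m ->
  annulus_cover x0 k m (18 * c * expR 3 + 2) (shadow_nbhd k @` C).
Proof.
move=> k0 c0 lebC meshC ordC; split.
- by move=> _ [U CU <-]; exact: dist_open_shadow_nbhd.
- by move=> _ [U CU <-]; exact: shadow_nbhd_shell.
- move=> _ x y [U CU <-] Ux Uy.
  have sx := shadow_nbhd_shell Ux; have sy := shadow_nbhd_shell Uy.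
  have [xi xix] := shell_ray_through k0 sx.
  have [eta etay] := shell_ray_through k0 sy.
  have bU : boundary_dist x0 xi eta <= c * (18 * expR (- k%:R)).
    rewrite -lee_fin (le_trans _ meshC)//.
    apply: (@le_trans _ _ (diam (boundary_dist x0) U)).
      apply: ereal_sup_ubound; exists xi, eta; split=> //.
        exact: shadow_nbhd_sub Ux xix.
      exact: shadow_nbhd_sub Uy etay.
    by apply: ereal_sup_ubound; exists U.
  have h := dist_le_boundary_dist xix etay.
  move: sx sy => /andP[kx xk] /andP[ky yk].
  apply: (le_trans h); apply: lerD; last first.
    by rewrite ler_norml; apply/andP; split; lra.
  apply: (@le_trans _ _ (expR (mdist x0 x + 1) * (c * (18 * expR (- k%:R))))).
    by rewrite ler_wpM2l ?expR_ge0.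
  have -> : expR (mdist x0 x + 1) * (c * (18 * expR (- k%:R))) =
      18 * c * expR (mdist x0 x + 1 - k%:R) by rewrite [in RHS]expRD; ring.
  rewrite ler_wpM2l ?mulr_ge0// ler_expR; lra.
- move=> x kx.
  have [xi xix] : exists xi, ray_through x xi.
    apply: (@shell_ray_through k) => //; move: kx => /andP[h1 h2].
    by rewrite -natr1 in h2; apply/andP; split; lra.
  have : ((9 * expR (- k%:R))%:E <
      ereal_sup [set dist_to (boundary_dist x0) xi (~` U) | U in C])%E.
    apply: (@lt_le_trans _ _ (18 * expR (- k%:R))%:E).
      by rewrite lte_fin ltr_pM2r ?expR_gt0// ltr_nat.
    by apply: le_trans lebC _; apply: ereal_inf_lbound; exists xi.
  move=> /ereal_sup_gt[_ [U CU <-] xiU].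
  exists (shadow_nbhd k U); first by exists U.
  by exists x; split=> //; [rewrite mdistxx radius_gt0|exists xi].
- move=> y; have [sy|nsy] := pselect (shell x0 k y); last first.
    apply: (@card_le_trans _ _ _ (@set0 nat)); last exact: subset_card_le.
    apply/card_le0P/seteqP; split=> // _ [[U CU <-] /shadow_nbhd_shell].
    exact: nsy.
  have [eta etay] := shell_ray_through k0 sy.
  apply: card_le_trans (ordC eta).
  apply: card_le_trans (card_image_le (shadow_nbhd k) _).
  apply: subset_card_le => _ [[U CU <-] Uy].
  by exists U => //; split=> //; exact: shadow_nbhd_sub Uy etay.
Qed.

End Shadow_covers.

Theorem theorem4p2p1 (R : realType) (X : metricType R) (x0 : X) (n : nat) :
  proper_space X -> CAT0 X -> geodesically_complete X ->
  ldim_le (boundary_dist x0) n ->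
  dim_mc_le (@mdist R X) (2 * n + 1).
Proof.
move=> _ catX gcX [c [l0 [c1 l00 coverP]]].
(* From index K on, the scale 18 exp (- k) is at most l0. *)
pose K := (Num.truncn (18 / l0)).+1.
have c0 : 0 <= c := le_trans ler01 c1.
have B10 : 0 <= 18 * c * expR 3 + 2 by rewrite addr_ge0// !mulr_ge0 ?expR_ge0.
apply: (@dim_mc_le_annuli _ _ x0 n (2 * K%:R + 3 + (18 * c * expR 3 + 2))) => k.
have [kK|Kk] := ltnP k K.
  exists [set shell x0 k].
  apply: annulus_cover_le (annulus_cover_shell x0 k n).
  have : k%:R <= K%:R :> R by rewrite ler_nat ltnW.
  lra.
have lk : 0 < 18 * expR (- k%:R : R) <= l0.
  apply/andP; split; first by rewrite mulr_gt0 ?expR_gt0.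
  rewrite expRN ler_pdivrMr ?expR_gt0//.
  rewrite mulrC -ler_pdivrMr//.
  have q0 : 0 <= 18 / l0 by rewrite divr_ge0// ltW.
  have /andP[_ /ltW h] := truncn_itv q0.
  apply: (le_trans h); apply: (@le_trans _ _ k%:R); first by rewrite ler_nat.
  by rewrite (le_trans _ (expR_ge1Dx _))// lerDr.
have [C [_ _ lebC meshC ordC]] := coverP _ lk.
exists (shadow_nbhd x0 k @` C).
apply: annulus_cover_le (annulus_cover_shadow catX gcX _ c0 lebC meshC ordC).
  by rewrite lerDr addr_ge0// mulr_ge0.
exact: leq_trans Kk.
Qed.
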